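(* For every $n\geq 3$, the cycle $C_n$ on $n$ vertices satisfies $$F_d(C_n)=\begin{cases}\lfloor n/3\rfloor+1 & \text{if } n\equiv 0,1 \pmod 3,\\ \lfloor n/3\rfloor+2 & \text{if } n\equiv 2 \pmod 3.\end{cases}$$
   Context: Zero forcing: given a set $B\subseteq V(G)$ of initially black vertices (all others white) of a finite simple graph $G$, at each step a black vertex having exactly one white neighbor forces that neighbor to become black; $B$ is a zero forcing set of $G$ if repeated application of this rule turns all vertices black. A set $D\subseteq V(G)$ is dominating if every vertex of $G$ is in $D$ or adjacent to a vertex of $D$. A dom-forcing set of $G$ is a set $D_f\subseteq V(G)$ that is both a dominating set of $G$ and a zero forcing set of $G$; the dom-forcing number $F_d(G)$ is the minimum cardinality of a dom-forcing set. *)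

(* Defs.v *)
From mathcomp Require Import all_boot.

Set Implicit Arguments.
Unset Strict Implicit.
Unset Printing Implicit Defensive.

Record sgraph := SGraph {
  vertex :> finType;
  adj : rel vertex;
  adj_sym : symmetric adj;
  adj_irr : irreflexive adj }.

Arguments adj {s} u v.

Definition nbhd (G : sgraph) (u : G) : {set G} := [set v | adj u v].

Definition dominating (G : sgraph) (D : {set G}) : bool :=
  [forall v, (v \in D) || [exists u in D, adj u v]].

(* [B] is the set of black vertices; [v] is the unique white neighbour of [u]. *)
Definition forces (G : sgraph) (B : {set G}) (u v : G) : bool :=
  (u \in B) && (nbhd u :\: B == [set v]).

Definition force_step (G : sgraph) : rel {set G} :=
  fun B B' => [exists u, exists v, forces B u v && (B' == v |: B)].

Definition zero_forcing (G : sgraph) (B : {set G}) : bool :=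
  connect (@force_step G) B [set: G].

Definition dom_forcing (G : sgraph) (D : {set G}) : bool :=
  dominating D && zero_forcing D.

Lemma dom_forcing_setT (G : sgraph) : dom_forcing [set: G].
Proof.
by rewrite /dom_forcing /zero_forcing connect0 andbT; apply/forallP=> v; rewrite inE.
Qed.

(* The minimum is attained since [set: G] is dom-forcing. *)
Definition dom_forcing_number (G : sgraph) : nat :=
  #|[arg min_(D < [set: G] | dom_forcing D) #|D| ]|.

Lemma dom_forcing_numberP (G : sgraph) :
  (exists2 D : {set G}, dom_forcing D & #|D| = dom_forcing_number G) /\
  (forall D : {set G}, dom_forcing D -> dom_forcing_number G <= #|D|).
Proof.
rewrite /dom_forcing_number; case: arg_minnP; first exact: dom_forcing_setT.
by move=> D dfD minD; split; first exists D.
Qed.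

(* The conjunct [i != j] only removes the loop when [n = 1]. *)
Definition cycle_adj (n : nat) : rel 'I_n :=
  fun i j => (i != j) && ((i.+1 %% n == j) || (j.+1 %% n == i)).

Lemma cycle_adj_sym n : symmetric (@cycle_adj n).
Proof. by move=> i j; rewrite /cycle_adj eq_sym orbC. Qed.

Lemma cycle_adj_irr n : irreflexive (@cycle_adj n).
Proof. by move=> i; rewrite /cycle_adj eqxx. Qed.

Definition cycle_graph (n : nat) : sgraph :=
  SGraph (@cycle_adj_sym n) (@cycle_adj_irr n).

(* Main.v *)
(** A dom-forcing set [D] of size [k] contains two cyclically consecutive
    vertices: this is clear if it is everything, and otherwise the first force
    needs a vertex of [D] with a neighbour in [D].  Writing [s] for the cyclic
    shift, domination says that [D], [s D] and [s^-1 D] cover the cycle, and the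
    consecutive pair makes [D] meet both [s D] and [s^-1 D], so [n <= 3k - 2].
    Conversely [{0} ∪ {i | i = 1 mod 3}] is dom-forcing, and the forces can be
    performed in the order [2, 3, ..., n - 1].  Both residue cases of the formula
    are [(n + 1) / 3 + 1]. *)
Require Import Defs.
From mathcomp Require Import all_boot zify.

Lemma cycle_adjE {n} (i j : 'I_n) :
  cycle_adj i j = (i != j) && ((ordS i == j) || (ordS j == i)).
Proof. by []. Qed.

Lemma val_ordS {n} (i : 'I_n) : ordS i = (if i.+1 == n then 0 else i.+1) :> nat.
Proof.
rewrite /=; case: eqP => [->|neq]; first exact: modnn.
by rewrite modn_small //; have := ltn_ord i; lia.
Qed.

Lemma ordS_neq {n} (i : 'I_n) : 1 < n -> ordS i != i.
Proof. by move=> n1; apply/eqP => /(congr1 (@nat_of_ord n)); rewrite val_ordS; case: eqP; lia. Qed.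

(** Otherwise a shift by two would fix [i], so [n] would divide 2. *)
Lemma ordS_neq_pred {n} (i : 'I_n) : 2 < n -> ordS i != ord_pred i.
Proof.
move=> n2; apply/eqP => /(congr1 (fun j => nat_of_ord (ordS j))).
by rewrite ord_predK !val_ordS; do 2! case: eqP; lia.
Qed.

Lemma cycle_adjS {n} (i : 'I_n) : 1 < n -> cycle_adj i (ordS i).
Proof. by move=> n1; rewrite cycle_adjE eqxx eq_sym ordS_neq. Qed.

Lemma zero_forcing_first {G : sgraph} {B : {set G}} :
  zero_forcing B -> B = [set: G] \/ exists u v, forces B u v.
Proof.
case/connectP => -[|B' p] /=; first by left.
by case/andP => /existsP[u /existsP[v /andP[fuv _]]] _ _; right; exists u, v.
Qed.

Lemma zero_forcing_cycle_pair {n} {D : {set cycle_graph n}} : 2 < n ->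
  zero_forcing D -> exists a : 'I_n, (a \in D) && (ordS a \in D).
Proof.
move=> n2 /zero_forcing_first[->|[u [v /andP[uD /eqP white]]]].
  by exists (Ordinal (ltnW (ltnW n2))); rewrite !inE.
have [SuD|SuD] := boolP (ordS u \in D); first by exists u; rewrite uD.
have [PuD|PuD] := boolP (ord_pred u \in D).
  by exists (ord_pred u); rewrite PuD ord_predK.
have n1 := ltnW n2.
(* If both neighbours of [u] were white, each would be the unique forced vertex [v], yet they are
   distinct. *)
have Sv : (ordS u : cycle_graph n) \in [set v].
  by rewrite -white !inE SuD; apply: cycle_adjS.
have Pv : (ord_pred u : cycle_graph n) \in [set v].
  rewrite -white !inE PuD /= cycle_adj_sym -{2}(ord_predK u).
  exact: cycle_adjS.
by move: (ordS_neq_pred u n2); rewrite (set1P Sv) (set1P Pv) eqxx.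
Qed.

Lemma dom_forcing_cycle_lower {n} {D : {set cycle_graph n}} : 2 < n ->
  dom_forcing D -> n + 2 <= 3 * #|D|.
Proof.
move=> n2 /andP[/forallP domD /(zero_forcing_cycle_pair n2)[a /andP[aD SaD]]].
pose S : {set cycle_graph n} := [set ordS i | i in D].
pose P : {set cycle_graph n} := [set ord_pred i | i in D].
(* Each of the two overlaps saves one vertex: [D :|: S] has at most [2 * #|D| - 1] elements and
   [P :\: D] at most [#|D| - 1]. *)
have cover : [set: cycle_graph n] \subset (D :|: S) :|: (P :\: D).
  apply/subsetP => v _; rewrite !inE.
  case/orP: (domD v) => [->//|/existsP[u /andP[uD /andP[_ /orP[/eqP Suv|/eqP Svu]]]]].
    suff -> : v \in S by rewrite orbT.
    by apply/imsetP; exists u => //; apply: val_inj.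
  suff -> : v \in P by rewrite andbT; case: (v \in D); rewrite ?orbT.
  apply/imsetP; exists u => //.
  by rewrite -[LHS]ordSK; congr ord_pred; apply: val_inj.
have meetS : 0 < #|D :&: S|.
  by apply/card_gt0P; exists (ordS a); rewrite inE SaD imset_f.
have meetP : 0 < #|P :&: D|.
  by apply/card_gt0P; exists a; rewrite inE aD andbT -[a]ordSK imset_f.
have := leq_trans (subset_leq_card cover) (leq_card_setU _ _).
have := cardsUI D S; have := cardsID D P.
have cardS : #|S| <= #|D| by apply: leq_imset_card.
have cardP : #|P| <= #|D| by apply: leq_imset_card.
rewrite cardsT card_ord; lia.
Qed.

(** Induction on [k] blackens all vertices below [k]: vertex [k], if still white, is forced by
    [k - 1], whose other neighbour [k - 2] is already black. *)
Lemma zero_forcing_cycle {n} (D : {set cycle_graph n}) :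
  (forall i : 'I_n, i < 2 -> (i : cycle_graph n) \in D) -> zero_forcing D.
Proof.
move=> D01; pose B k : {set cycle_graph n} := D :|: [set i : 'I_n | i < k].
suff forced : forall k, connect (@force_step (cycle_graph n)) D (B k).
  suff BnT : B n = setT by rewrite /zero_forcing -BnT; apply: forced.
  by apply/setP => i; rewrite !inE ltn_ord orbT.
(* Covers the stages without a force: [k] is already black, or [k >= n] and the premise is
   vacuous. *)
have stable k : (forall i : 'I_n, i = k :> nat -> (i : cycle_graph n) \in B k) ->
    B k.+1 = B k.
  move=> kB; apply/setP => i; rewrite !inE ltnS leq_eqVlt.
  by case: eqP => [/kB|//]; rewrite !inE => ->; rewrite orbT.
elim=> [|k IHk].
  suff -> : B 0 = D by apply: connect0.
  by apply/setP => i; rewrite !inE orbF.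
have [kn|nk] := ltnP k n; last first.
  by rewrite stable // => i ik; have := ltn_ord i; lia.
pose v : cycle_graph n := Ordinal kn.
have [vB|vB] := boolP (v \in B k).
  by rewrite stable // => i ik; rewrite (_ : i = v) //; apply: val_inj.
have k2 : 1 < k.
  by rewrite ltnNge; apply: contra vB => k1; rewrite inE D01.
have un : k.-1 < n by lia.
pose u : cycle_graph n := Ordinal un.
apply: connect_trans IHk (connect1 _); apply/existsP; exists u.
apply/existsP; exists v; apply/andP; split; last first.
  apply/eqP/setP => i; rewrite !inE ltnS leq_eqVlt.
  by rewrite -(inj_eq (@ord_inj n)) orbCA.
rewrite /forces !inE /= prednK ?leqnn ?orbT /=; last by lia.
apply/eqP/setP => w; rewrite inE in_setD.
have [->|wv] := eqVneq w v.
  rewrite vB inE /= cycle_adjE -!(inj_eq (@ord_inj n)) !val_ordS /=.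
  by apply/andP; split; [|apply/orP; left; case: ifP]; lia.
apply/negbTE; rewrite !inE /= cycle_adjE; apply/negP.
(* A white [w] other than [v] satisfies [k < w], so it cannot precede [u]: wrapping around would
   require [u = 0], but [k >= 2]. *)
move=> /andP[]; rewrite negb_or => /andP[_ wk] /andP[_].
move: wv; rewrite -!(inj_eq (@ord_inj n)) !val_ordS /= => wv.
by have := ltn_ord w; do 2! case: ifP; lia.
Qed.

Lemma dom_forcing_cycle_upper {n} : 2 < n ->
  exists2 D : {set cycle_graph n}, dom_forcing D & #|D| <= (n + 1) %/ 3 + 1.
Proof.
case: n => // n n2.
(* The index bound counts the vertices congruent to 1 mod 3, so [3 * j + 1] stays in range and
   [inord] never takes its default value. *)
pose D : {set cycle_graph n.+1} :=
  ord0 |: [set inord (3 * j + 1) | j : 'I_((n.+1 + 1) %/ 3)].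
have inD (i : 'I_n.+1) : (i == 0 :> nat) || (i %% 3 == 1) -> (i : cycle_graph n.+1) \in D.
  case/orP => [/eqP i0|/eqP i1]; rewrite !inE.
    by apply/orP; left; apply/eqP/val_inj.
  apply/orP; right; apply/imsetP.
  have ilt : i %/ 3 < (n.+1 + 1) %/ 3 by have := ltn_ord i; lia.
  exists (Ordinal ilt) => //; apply: val_inj.
  by rewrite /= inordK; have := ltn_ord i; lia.
exists D; last first.
  rewrite addnC; apply: leq_trans (leq_card_setU _ _) _; rewrite cards1 leq_add2l.
  by apply: leq_trans (leq_imset_card _ _) _; rewrite card_ord.
apply/andP; split; last first.
  by apply: zero_forcing_cycle => i i2; apply: inD; lia.
apply/forallP => /= v; apply/orP.
have [vD|vD] := boolP (v \in D); [by left|right].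
have {vD} : ~~ ((v == 0 :> nat) || (v %% 3 == 1)) by apply: contra vD; apply: inD.
move=> vD; have vn := ltn_ord v.
have [v2|v2] := eqVneq (v %% 3) 2.
  apply/existsP; exists (ord_pred v); rewrite /= -{3}(ord_predK v).
  rewrite cycle_adjS ?andbT; last by lia.
  apply: inD; have := congr1 (@nat_of_ord n.+1) (ord_predK v); rewrite val_ordS.
  by case: ifP; lia.
(* Here [v] is a nonzero multiple of 3; its successor is 1 mod 3, or is 0 when [v] is the last
   vertex. *)
apply/existsP; exists (ordS v); rewrite /= cycle_adj_sym cycle_adjS ?andbT; last by lia.
by apply: inD; rewrite val_ordS; case: ifP; lia.
Qed.

Lemma dom_forcing_number_cycle n : 2 < n ->
  dom_forcing_number (cycle_graph n) = (n + 1) %/ 3 + 1.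
Proof.
move=> n2; have [[D dfD cardD] minD] := dom_forcing_numberP (cycle_graph n).
have [E dfE cardE] := dom_forcing_cycle_upper n2.
(* The bounds meet because the ceiling of [(n + 2) / 3] is [(n + 1) %/ 3 + 1]. *)
have := dom_forcing_cycle_lower n2 dfD; have := minD E dfE; lia.
Qed.

Theorem theorem2p7 (n : nat) (hn : 3 <= n) :
  (n = 0 %[mod 3] \/ n = 1 %[mod 3] ->
     dom_forcing_number (cycle_graph n) = n %/ 3 + 1) /\
  (n = 2 %[mod 3] ->
     dom_forcing_number (cycle_graph n) = n %/ 3 + 2).
Proof. by rewrite dom_forcing_number_cycle //; split; lia. Qed.
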